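(* The map $(c,\mathbf t)\mapsto$ (distribution of $c+\mathcal S_{\mathbf t}$) is a bijection from $\mathbb R\times\{\mathbf t\in\widetilde\ell_2:\mathbf t\text{ has finite support}\}$ onto the set of finite generalized uniform sum distributions, i.e. distributions of random variables $\sum_{k=1}^m\mathcal U[\alpha_k,\beta_k]$ with $m$ finite, $\alpha_k\le\beta_k$, and independent summands.
   Context: $\mathcal U[a,b]$ is the continuous uniform distribution on $[a,b]$. $\widetilde\ell_2=\{\mathbf t=(t_1,t_2,\dots):t_1\ge t_2\ge\dots\ge0,\ \sum t_k^2<\infty\}$. For finitely supported $\mathbf t\in\widetilde\ell_2$, $\mathcal S_{\mathbf t}=\sum_k\mathcal U[-t_k/2,t_k/2]$ with independent summands. *)

(* Defs.v *)
From HB Require Import structures.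
From mathcomp Require Import all_boot all_order all_algebra finmap.
From mathcomp Require Import all_classical all_reals all_analysis.
From mathcomp Require Import measurable_realfun.

Set Implicit Arguments.
Unset Strict Implicit.
Unset Printing Implicit Defensive.

Import Order.TTheory GRing.Theory Num.Theory.
Import numFieldTopology.Exports numFieldNormedType.Exports.

Local Open Scope classical_set_scope.
Local Open Scope ring_scope.

(* A library measure is a function on all sets, whose values on non-measurable
   sets carry no information. A distribution on the line is therefore taken as
   a set function on Borel sets only, so that equality of distributions is
   Leibniz equality. *)
Definition borel_law (R : realType) : Type :=
  {A : set R | measurable A} -> \bar R.

Definition to_law (R : realType) (mu : set R -> \bar R) : borel_law R :=
  fun A => mu (sval A).

Definition law (R : realType) (d : measure_display) (T : measurableType d)
    (P : probability T R) (X : {RV P >-> R}) : borel_law R :=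
  to_law (distribution P X).

(* U[a, b] for a <= b; U[a, a] is the point mass at a (the value for b < a is
   irrelevant). *)
Definition uniform_law (R : realType) (a b : R) : borel_law R :=
  match pselect (a < b) with
  | left ab => to_law (uniform_prob ab)
  | right _ => to_law (dirac a)
  end.

Definition mutually_independent (R : realType) (d : measure_display)
    (T : measurableType d) (P : probability T R) (I : choiceType)
    (X : I -> {RV P >-> R}) : Prop :=
  forall (J : {fset I}) (B : I -> set R),
    (forall i, measurable (B i)) ->
    P (\bigcap_(i in [set` J]) (X i @^-1` B i)) =
    (\prod_(i <- J) P (X i @^-1` B i))%E.

Definition independent_uniforms (R : realType) (d : measure_display)
    (T : measurableType d) (P : probability T R) (I : choiceType)
    (a b : I -> R) (X : I -> {RV P >-> R}) : Prop :=
  mutually_independent X /\ forall i, law (X i) = uniform_law (a i) (b i).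

Definition l2_decr (R : realType) : set (R ^nat) :=
  [set t : R ^nat | [/\ forall k, t k.+1 <= t k, forall k, 0 <= t k &
               cvgn (series (fun k => t k ^+ 2))]].
Arguments l2_decr : clear implicits.

Definition support_set (R : realType) (t : R ^nat) : set nat :=
  [set k | t k != 0].

Definition l2_decr_fin (R : realType) : set (R ^nat) :=
  [set t : R ^nat | l2_decr R t /\ finite_set (support_set t)].
Arguments l2_decr_fin : clear implicits.

(* nu is the distribution of c + S_t, for t of finite support: the summands
   outside the support are U[0, 0], hence almost surely 0. *)
Definition is_law_shifted_S (R : realType) (c : R) (t : R ^nat)
    (nu : borel_law R) : Prop :=
  exists (d : measure_display) (T : measurableType d) (P : probability T R)
         (X : nat -> {RV P >-> R}),
    independent_uniforms (fun k => - (t k / 2)) (fun k => t k / 2) X /\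
    nu = law (cst c \+ \sum_(k \in support_set t) X k : {RV P >-> R}).

Definition finite_gen_unif_sum_law (R : realType) : set (borel_law R) :=
  [set nu | exists (m : nat) (alpha beta : 'I_m -> R),
    (forall k, alpha k <= beta k) /\
    exists (d : measure_display) (T : measurableType d) (P : probability T R)
           (X : 'I_m -> {RV P >-> R}),
      independent_uniforms alpha beta X /\
      nu = law (\sum_(k < m) X k : {RV P >-> R})].
Arguments finite_gen_unif_sum_law : clear implicits.

(* Main.v *)
Require Import Defs.
From HB Require Import structures.
From mathcomp Require Import all_boot all_order all_algebra finmap.
From mathcomp Require Import all_classical all_reals all_analysis.
From mathcomp Require Import measurable_realfun.
From mathcomp Require Import ring lra.

(** The law of a sum of independent variables is the iterated convolution of
    their laws, so [(c, t)] determines the law of [c + S_t].  Recentring the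
    summands and sorting their lengths on the given probability space gives
    surjectivity.  For injectivity, the moment generating function of
    [c + S_t] is [M(s) = e^(c s) prod_k sinh(s t_k / 2) / (s t_k / 2)], so that
      [M(2 s) / M(s) = e^(c s) prod_k cosh(s t_k / 2)],
    which for [n] factors is [2^(-n) e^(a s) prod_k (1 + e^(- s t_k))] with
    [a = c + sum_k t_k / 2].  The growth as [s] tends to infinity determines
    [a]; the remaining product is [1 + e^(- s t_min)] up to smaller terms, which
    determines the smallest [t_k], and this factor can be cancelled. *)

Set Implicit Arguments.
Unset Strict Implicit.
Unset Printing Implicit Defensive.

Import Order.TTheory GRing.Theory Num.Theory.
Import numFieldTopology.Exports numFieldNormedType.Exports.

Local Open Scope classical_set_scope.
Local Open Scope ring_scope.

(** * Exponential products *)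

(** If [d] were positive, the value at [s = C / d] would be e^C >= 1 + C > C. *)
Lemma expR_bounded_le0 (R : realType) (d C : R) :
  (forall s, 0 < s -> expR (s * d) <= C) -> d <= 0.
Proof.
move=> H; rewrite leNgt; apply/negP => d0.
have C0 : 0 < C by apply: lt_le_trans (H 1 ltr01); exact: expR_gt0.
have := H (C / d) (divr_gt0 C0 d0).
rewrite divfK ?gt_eqF// leNgt => /negP; apply.
by apply: lt_le_trans (expR_ge1Dx C); rewrite ltrDr.
Qed.

(** Induction gives the chord bound 1 + (2^n - 1) x, an equality at both ends of [0, 1]; the slack
    of a step is (2^n - 1) x (1 - x). *)
Lemma exprD1_le (R : realFieldType) (x : R) n :
  0 <= x <= 1 -> (1 + x) ^+ n <= 1 + 2 ^+ n * x.
Proof.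
case/andP => x0 x1.
suff : (1 + x) ^+ n <= 1 + (2 ^+ n - 1) * x by move/le_trans; apply; rewrite lerD2l ler_wpM2r// gerBl.
elim: n => [|n IHn]; first by rewrite !expr0 subrr mul0r addr0.
have p1 : 1 <= 2 ^+ n :> R by apply: exprn_ege1; rewrite ler1n.
rewrite !exprS.
apply: le_trans (ler_wpM2l _ IHn) _; first by rewrite addr_ge0.
rewrite -subr_ge0 (_ : _ - _ = (2 ^+ n - 1) * (x * (1 - x))); last by ring.
by rewrite !mulr_ge0// subr_ge0.
Qed.

Lemma prod_1DexpR_ge1 (R : realType) (t : seq R) (s : R) :
  1 <= \prod_(z <- t) (1 + expR (- (s * z))).
Proof.
elim/big_ind : _ => // [x y x1 y1|z _]; last by rewrite lerDl expR_ge0.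
by rewrite mulr_ege1.
Qed.

(** Every factor is at most 1 + e^(- s y), and [exprD1_le] bounds the power of this number. *)
Lemma prod_1DexpR_le (R : realType) (u : seq R) (y s : R) :
  0 <= y -> 0 < s -> all (>= y) u ->
  \prod_(z <- u) (1 + expR (- (s * z))) <= 1 + 2 ^+ size u * expR (- (s * y)).
Proof.
move=> y0 s0 /allP yu.
have e1 : 0 <= expR (- (s * y)) <= 1.
  by rewrite expR_ge0/= -expR0 ler_expR oppr_le0 mulr_ge0// ltW.
apply: le_trans (exprD1_le (size u) e1).
rewrite -iter_mulr_1 -[X in iter X]count_predT -big_const_seq [leLHS]big_seq [leRHS]big_seq.
apply: ler_prod => z zu; rewrite addr_ge0 ?expR_ge0//=.
by rewrite lerD2l ler_expR lerN2 ler_wpM2l ?yu// ltW.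
Qed.

(* As [s] tends to infinity, the left product is at least [1 + e^(-s x)] and
   the right one is [1 + O(e^(-s y))]. *)
Lemma prod_1DexpR_head_ge (R : realType) (t u : seq R) (x y : R) :
  0 <= x -> path <=%R y u ->
  (forall s, 0 < s -> \prod_(z <- x :: t) (1 + expR (- (s * z))) <=
                      \prod_(z <- y :: u) (1 + expR (- (s * z)))) ->
  y <= x.
Proof.
move=> x0 yu H; rewrite leNgt; apply/negP => xy.
have y0 : 0 <= y by rewrite (le_trans x0)// ltW.
have : y - x <= 0; last by rewrite subr_le0 leNgt xy.
apply: (@expR_bounded_le0 _ _ (2 ^+ size (y :: u))) => s s0.
have yyu : all (>= y) (y :: u) by rewrite /= lexx order_path_min//; exact: le_trans.
have := le_trans (H s s0) (prod_1DexpR_le y0 s0 yyu).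
(* The tail factors on the left are at least 1. Dropping them leaves e^(- s x) <= 2^n e^(- s y), so
   e^(s (y - x)) stays bounded. *)
rewrite big_cons => /(le_trans _) -/(_ (1 + expR (- (s * x))))/=.
rewrite ler_peMr ?prod_1DexpR_ge1 ?addr_ge0 ?expR_ge0// => /(_ isT).
rewrite lerD2l -ler_pdivrMr ?expR_gt0// -expRN -expRD opprK.
by rewrite mulrBr addrC.
Qed.

(** Ascending order puts the slowest-decaying exponential first. Comparison both ways identifies the
    heads, whose positive factor cancels. *)
Lemma prod_1DexpR_inj (R : realType) (t u : seq R) :
  size t = size u -> all (>= 0) t -> all (>= 0) u ->
  sorted <=%R t -> sorted <=%R u ->
  (forall s, 0 < s -> \prod_(z <- t) (1 + expR (- (s * z))) =
                      \prod_(z <- u) (1 + expR (- (s * z)))) ->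
  t = u.
Proof.
elim: t u => [|x t IHt] [|y u]//= [tu] /andP[x0 t0] /andP[y0 u0] xt yu H.
have xy : x = y.
  apply/le_anti; apply/andP; split.
    by apply: (prod_1DexpR_head_ge (t := u) y0 xt) => s s0; rewrite H.
  by apply: (prod_1DexpR_head_ge (t := t) x0 yu) => s s0; rewrite H.
subst y; congr cons; apply: IHt => //; [exact: path_sorted xt|exact: path_sorted yu|].
move=> s s0; have := H s s0; rewrite !big_cons; apply: mulfI.
by rewrite gt_eqF// ltr_pwDl// expR_ge0.
Qed.

(** Pulling e^(s x / 2) out of each factor collects the exponent c + sum x / 2, the right end of the
    support of the law. *)
Lemma prod_expR_cosh (R : realType) (t : seq R) (c s : R) :
  expR (c * s) * \prod_(x <- t) (expR (s * (x / 2)) + expR (- (s * (x / 2)))) =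
  expR (s * (c + \sum_(x <- t) x / 2)) * \prod_(x <- t) (1 + expR (- (s * x))).
Proof.
rewrite (eq_bigr (fun x => expR (s * (x / 2)) * (1 + expR (- (s * x))))).
  by rewrite big_split/= -expR_sum mulrA -expRD mulrDr mulr_sumr [c * s]mulrC.
move=> x _; rewrite mulrDr mulr1 -expRD; congr (_ + expR _).
by field.
Qed.

(** After [prod_expR_cosh], the remaining product is at least 1 on the left and, by [prod_1DexpR_le]
    with [y = 0], at most 1 + 2^n on the right; hence the leading exponents are ordered. *)
Lemma prod_expR_cosh_le (R : realType) (t u : seq R) (c d : R) :
  all (>= 0) u ->
  (forall s, 0 < s ->
    expR (c * s) * \prod_(x <- t) (expR (s * (x / 2)) + expR (- (s * (x / 2)))) <=
    expR (d * s) * \prod_(x <- u) (expR (s * (x / 2)) + expR (- (s * (x / 2))))) ->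
  c + \sum_(x <- t) x / 2 <= d + \sum_(x <- u) x / 2.
Proof.
move=> u0 H; rewrite -subr_le0.
apply: (@expR_bounded_le0 _ _ (1 + 2 ^+ size u)) => s s0.
rewrite mulrBr expRD expRN ler_pdivrMr ?expR_gt0//.
have := H s s0; rewrite !prod_expR_cosh => H1.
apply: le_trans (le_trans H1 _).
  by rewrite ler_peMr ?expR_ge0 ?prod_1DexpR_ge1.
rewrite mulrC ler_pM2r ?expR_gt0//.
apply: le_trans (prod_1DexpR_le (lexx 0) s0 u0) _.
by rewrite mulr0 oppr0 expR0 mulr1.
Qed.

Lemma prod_expR_cosh_inj (R : realType) (t u : seq R) (c d : R) :
  size t = size u -> all (>= 0) t -> all (>= 0) u ->
  sorted <=%R t -> sorted <=%R u ->
  (forall s, 0 < s ->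
    expR (c * s) * \prod_(x <- t) (expR (s * (x / 2)) + expR (- (s * (x / 2)))) =
    expR (d * s) * \prod_(x <- u) (expR (s * (x / 2)) + expR (- (s * (x / 2))))) ->
  c = d /\ t = u.
Proof.
move=> tu t0 u0 st su H.
have E : c + \sum_(x <- t) x / 2 = d + \sum_(x <- u) x / 2.
  by apply/le_anti; rewrite !prod_expR_cosh_le// => s s0; rewrite H.
suff tE : t = u by split => //; move: E; rewrite tE => /addIr.
apply: prod_1DexpR_inj => // s s0.
have := H s s0; rewrite !prod_expR_cosh E; apply: mulfI.
by rewrite gt_eqF// expR_gt0.
Qed.

(** * Convolution and moment generating functions *)

Definition mfun_of (d d' : measure_display) (T : measurableType d)
    (T' : measurableType d') (f : T -> T') (mf : measurable_fun [set: T] f) :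
  {mfun T >-> T'} := HB.pack f (isMeasurableFun.Build _ _ _ _ _ mf).

Lemma measurable_sum2 (R : realType) :
  measurable_fun [set: R * R] (fun z : R * R => z.1 + z.2).
Proof. by apply: measurable_funD; [exact: measurable_fst|exact: measurable_snd]. Qed.

Definition convolution (R : realType) (mu nu : probability R R) : probability R R :=
  distribution (mu \x nu)%E (mfun_of (@measurable_sum2 R)).

Definition mgf (R : realType) (mu : probability R R) (s : R) : \bar R :=
  (\int[mu]_x (expR (s * x))%:E)%E.

Lemma measurable_expRM (R : realType) (s : R) :
  measurable_fun [set: R] (fun x => (expR (s * x))%:E).
Proof. by apply/measurable_EFinP; apply: measurableT_comp. Qed.

Lemma mgf_dirac (R : realType) (c s : R) : mgf (dirac c) s = (expR (c * s))%:E.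
Proof.
rewrite /mgf integral_dirac//; last exact: measurable_expRM.
by rewrite diracT mul1e mulrC.
Qed.

Lemma mgf_ge0 (R : realType) (mu : probability R R) (s : R) : (0 <= mgf mu s)%E.
Proof. by apply: integral_ge0 => x _; rewrite lee_fin expR_ge0. Qed.

(** Tonelli for e^(s x) e^(s y) >= 0; with values in the extended reals no integrability is
    required. *)
Lemma mgf_convolution (R : realType) (mu nu : probability R R) (s : R) :
  mgf (convolution mu nu) s = (mgf mu s * mgf nu s)%E.
Proof.
have e0 (x : R) : (0 <= (expR (s * x))%:E)%E by rewrite lee_fin expR_ge0.
rewrite /mgf (ge0_integral_distribution _ (measurable_expRM s))//.
rewrite fubini_tonelli1//; last 2 first.
- exact: (measurableT_comp (measurable_expRM s) (@measurable_sum2 R)).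
- by move=> x; rewrite lee_fin expR_ge0.
rewrite -ge0_integralZr//; last 2 first.
- exact: measurable_expRM.
- exact: mgf_ge0.
apply: eq_integral => x _; rewrite /fubini_F/=.
rewrite -ge0_integralZl//; last exact: measurable_expRM.
by apply: eq_integral => y _; rewrite mulrDr expRD EFinM.
Qed.

Lemma measurable_idR (R : realType) :
  measurable_fun [set: measurableTypeR R] (idfun : measurableTypeR R -> R).
Proof. exact: measurable_id. Qed.

(* The uniform measures of the library live on [measurableTypeR R], which has
   the same measurable sets as [R] but another display. *)
Definition uniform_or_dirac (R : realType) (a b : R) : probability R R :=
  match pselect (a < b) with
  | left ab => distribution (uniform_prob ab) (mfun_of (@measurable_idR R))
  | right _ => dirac a
  end.

Lemma to_law_uniform_or_dirac (R : realType) (a b : R) :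
  to_law (uniform_or_dirac a b) = uniform_law a b.
Proof. by rewrite /uniform_or_dirac /uniform_law; case: pselect. Qed.

Lemma mgf_uniform (R : realType) (a b s : R) (ab : a < b) :
  mgf (distribution (uniform_prob ab) (mfun_of (@measurable_idR R))) s =
  ((b - a)^-1%:E * \int[lebesgue_measure]_(x in `[a, b]) (expR (s * x))%:E)%E.
Proof.
have e0 (x : R) : (0 <= (expR (s * x))%:E)%E by rewrite lee_fin expR_ge0.
rewrite /mgf (ge0_integral_distribution _ (measurable_expRM s))//.
by rewrite integral_uniform//; exact: measurable_expRM.
Qed.

Lemma integral_expRM (R : realType) (a b s : R) : a < b -> s != 0 ->
  (\int[lebesgue_measure]_(x in `[a, b]) (expR (s * x))%:E =
   ((expR (s * b) - expR (s * a)) / s)%:E)%E.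
Proof.
move=> ab s0.
have dF (x : R) : is_derive x 1 (fun x => expR (s * x) / s) (expR (s * x)).
  apply: is_derive_eq.
  by rewrite /GRing.scale/= mulr1; field.
have cF (x : R) : {for x, continuous (fun x => expR (s * x) / s)}.
  by apply/differentiable_continuous/derivable1_diffP/(@ex_derive _ _ _ _ _ _ _ (dF x)).
rewrite (continuous_FTC2 (F := fun x => expR (s * x) / s) ab).
- by rewrite -EFinB mulrBl.
- apply: continuous_subspaceT => x.
  apply: (@continuous_comp _ _ _ (fun x => s * x) expR); last exact: continuous_expR.
  exact: mulrl_continuous.
- split => [x _||].
  + exact: (@ex_derive _ _ _ _ _ _ _ (dF x)).
  + exact/cvg_at_right_filter/cF.
  + exact/cvg_at_left_filter/cF.
- by move=> x _; rewrite derive1E; exact: derive_val.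
Qed.

(* Doubling the argument removes the denominator of
   [(e^(s t / 2) - e^(- s t / 2)) / (s t)]. *)
Lemma mgf_centered_uniform (R : realType) (t s : R) : 0 <= t -> 0 < s ->
  exists2 m : R, 0 < m &
    mgf (uniform_or_dirac (- (t / 2)) (t / 2)) s = m%:E /\
    mgf (uniform_or_dirac (- (t / 2)) (t / 2)) (2 * s) =
      (m * ((expR (s * (t / 2)) + expR (- (s * (t / 2)))) / 2))%:E.
Proof.
move=> t0 s0; rewrite /uniform_or_dirac; case: pselect => [ab|/negP].
  have t_gt0 : 0 < t by lra.
  (* The transform at [s], that is sinh(s t / 2) / (s t / 2). *)
  exists ((expR (s * (t / 2)) - expR (- (s * (t / 2)))) / (s * t)).
    apply: divr_gt0; last exact: mulr_gt0.
    by rewrite subr_gt0 ltr_expR gtrN// mulr_gt0// divr_gt0.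
  split.
    rewrite mgf_uniform.
    rewrite integral_expRM ?gt_eqF// -EFinM mulrN; congr EFin.
    by field; rewrite !gt_eqF//=; lra.
  rewrite mgf_uniform.
  rewrite integral_expRM ?gt_eqF ?mulr_gt0// -EFinM; congr EFin.
  (* With a = s t / 2, the numerator is the difference of squares e^(2 a) - e^(- 2 a) = (e^a - e^(-
     a)) (e^a + e^(- a)). *)
  rewrite (_ : 2 * s * (t / 2) = s * (t / 2) + s * (t / 2)); last by ring.
  rewrite (_ : 2 * s * - (t / 2) = - (s * (t / 2)) - s * (t / 2)); last by ring.
  by rewrite !expRD; field; rewrite !gt_eqF//=; lra.
rewrite -leNgt => h; have -> : t = 0 by lra.
exists 1 => //; rewrite !mgf_dirac mul0r oppr0 !mul0r mulr0 oppr0 expR0; split => //.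
by rewrite mul1r; congr EFin; field.
Qed.

(** * Independence *)

Lemma bigcap_preimage_measurable (R : realType) (d : measure_display)
    (T : measurableType d) (I : Type) (X : I -> {mfun T >-> R})
    (s : seq I) (B : I -> set R) : (forall i, measurable (B i)) ->
  measurable (\big[setI/setT]_(i <- s) (X i @^-1` B i)).
Proof.
move=> mB; apply: bigsetI_measurable => i _; exact: measurable_funPTI.
Qed.

Lemma mutually_independent_seq (R : realType) (d : measure_display)
    (T : measurableType d) (P : probability T R) (I : choiceType)
    (X : I -> {RV P >-> R}) (s : seq I) (B : I -> set R) :
  mutually_independent X -> uniq s -> (forall i, measurable (B i)) ->
  P (\big[setI/setT]_(i <- s) (X i @^-1` B i)) =
  (\prod_(i <- s) P (X i @^-1` B i))%E.
Proof.
move=> iX us mB; have := iX [fset i in s]%fset B mB; rewrite bigcap_fset.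
have ps : perm_eq [fset i in s]%fset s.
  by apply: uniq_perm; rewrite ?fset_uniq// => i; rewrite in_fset.
by rewrite (perm_big _ ps) [in RHS](perm_big _ ps).
Qed.

(** Each [Y k] is a function of its own [X i] or a constant. This covers recentring, reordering,
    padding with constants and replacing variables by constants. *)
Lemma mutually_independent_reindex (R : realType) (d : measure_display)
    (T : measurableType d) (P : probability T R) (I K : choiceType)
    (X : I -> {RV P >-> R}) (Y : K -> {RV P >-> R})
    (f : K -> option I) (g : K -> R -> R) (c : K -> R) :
  (forall k k' i, f k = Some i -> f k' = Some i -> k = k') ->
  (forall k, measurable_fun [set: R] (g k)) ->
  (forall k i, f k = Some i -> forall x, Y k x = g k (X i x)) ->
  (forall k, f k = None -> forall x, Y k x = c k) ->
  mutually_independent X -> mutually_independent Y.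
Proof.
move=> finj mg YX Yc iX.
(* For the induction, [r] accumulates the events on the [X i] into which events on the [Y k] have
   already been translated. *)
have main s : forall r B B', uniq s -> uniq r ->
    (forall k i, k \in s -> f k = Some i -> i \notin r) ->
    (forall k, measurable (B k)) -> (forall i, measurable (B' i)) ->
    P (\big[setI/setT]_(k <- s) (Y k @^-1` B k) `&`
       \big[setI/setT]_(i <- r) (X i @^-1` B' i)) =
    ((\prod_(k <- s) P (Y k @^-1` B k)) *
     \prod_(i <- r) P (X i @^-1` B' i))%E.
  elim: s => [|k s IHs] r B B'; rewrite ?big_nil.
    by move=> _ ur _ _ mB'; rewrite setTI mul1e mutually_independent_seq.
  rewrite cons_uniq => /andP[ks us] ur sr mB mB'; rewrite !big_cons.
  have sr' k' i : k' \in s -> f k' = Some i -> i \notin r.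
    by move=> k's; apply: sr; rewrite in_cons k's orbT.
  case fk : (f k) => [i|]; last first.
    (* An event on a constant variable is sure or impossible. *)
    have [kB|kB] := pselect (B k (c k)).
      rewrite (_ : Y k @^-1` B k = setT); last first.
        by apply/seteqP; split => x //= _; rewrite Yc.
      by rewrite setTI probability_setT mul1e IHs.
    rewrite (_ : Y k @^-1` B k = set0); last first.
      by apply/seteqP; split => x //=; rewrite Yc.
    by rewrite !set0I measure0 !mul0e.
  pose B'' j := if j == i then g k @^-1` B k else B' j.
  have ir : i \notin r by apply: (sr k) => //; rewrite mem_head.
  have mB'' j : measurable (B'' j).
    rewrite /B''; case: ifP => // _.
    by rewrite -[X in measurable X]setTI; exact: mg.
  have Yk : Y k @^-1` B k = X i @^-1` B'' i.
    rewrite /B'' eqxx; apply/seteqP; split => x /=; by rewrite (YX _ _ fk).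
  have := IHs (i :: r) B B'' us; rewrite cons_uniq ir ur => /(_ isT).
  rewrite !big_cons -Yk.
  have rE j : j \in r -> X j @^-1` B'' j = X j @^-1` B' j.
    by move=> jr; rewrite /B''; case: eqP => // ji; rewrite -ji jr in ir.
  have -> : \big[setI/setT]_(j <- r) (X j @^-1` B'' j) =
            \big[setI/setT]_(j <- r) (X j @^-1` B' j).
    by rewrite big_seq [RHS]big_seq; apply: eq_bigr.
  have -> : (\prod_(j <- r) P (X j @^-1` B'' j) =
            \prod_(j <- r) P (X j @^-1` B' j))%E.
    by rewrite big_seq [RHS]big_seq; apply: eq_bigr => j /rE ->.
  move=> IH; rewrite -setIA setICA IH//; first by rewrite muleCA muleA.
  move=> k' j k's fk'; rewrite in_cons negb_or (sr' _ _ k's fk') andbT.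
  apply: contraNneq ks => ji; rewrite ji in fk'.
  by rewrite (finj _ _ _ fk fk').
move=> J B mB.
have := main J [::] B (fun=> setT) (fset_uniq J) isT (fun _ _ _ _ => isT) mB.
by rewrite !big_nil setIT mule1 bigcap_fset => ->.
Qed.

(** * Laws of sums of independent variables *)

Definition sum_law (R : realType) (I : Type) (mu : I -> probability R R)
    (s : seq I) : probability R R :=
  foldr (fun i => convolution (mu i)) (dirac (0 : R) : probability R R) s.

(** The events on the variables outside the sum strengthen the induction: adding [X i] to a partial
    sum requires that sum to be independent of [X i] together with the remaining events. *)
Lemma independent_sum_joint (R : realType) (d : measure_display)
    (T : measurableType d) (P : probability T R) (I : choiceType)
    (X : I -> {RV P >-> R}) (mu : I -> probability R R) (s r : seq I)
    (A : set R) (B : I -> set R) :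
  mutually_independent X ->
  (forall i A, measurable A -> P (X i @^-1` A) = mu i A) ->
  uniq (s ++ r) -> measurable A -> (forall i, measurable (B i)) ->
  P ((fun x => \sum_(i <- s) X i x) @^-1` A `&`
     \big[setI/setT]_(i <- r) (X i @^-1` B i)) =
  (sum_law mu s A * \prod_(i <- r) P (X i @^-1` B i))%E.
Proof.
move=> iX Xmu; elim: s r A B => [|i s IHs] r A B usr mA mB.
  rewrite (_ : _ @^-1` A = [set _ | A 0]); last first.
    by apply/seteqP; split => x /=; rewrite big_nil.
  rewrite /= diracE -mutually_independent_seq//.
  case: (asboolP (A 0)) => A0.
    rewrite mem_set// mul1e (_ : [set _ | A 0] = setT) ?setTI//.
    by apply/seteqP; split.
  rewrite memNset// mul0e (_ : [set _ | A 0] = set0) ?set0I ?measure0//.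
  by apply/seteqP; split.
set E := \big[setI/setT]_(j <- r) _.
have mE : measurable E by exact: bigcap_preimage_measurable.
pose W x := (X i x, \sum_(j <- s) X j x).
have mW : measurable_fun [set: T] W.
  apply: measurable_fun_pair; first exact: measurable_funPT.
  by apply: measurable_sum => j; exact: measurable_funPT.
pose k : {nonneg R} := NngNum (fine_ge0 (measure_ge0 P E)).
have kE : (k%:num%:E = P E)%E by rewrite /= fineK// fin_num_measure.
pose pushW : {measure set (R * R) -> \bar R} := pushforward (mrestr P mE) W.
pose m' := pushW mW.
have ur : uniq (i :: r).
  by move: usr => /=; rewrite mem_cat negb_or cat_uniq => /andP[/andP[_ ->] /and3P[]].
have joint S : measurable S -> m' S = (P E * (mu i \x sum_law mu s)%E S)%E.
  move=> mS.
  (* Agreement on rectangles suffices. Scaling [mu i] by P(E) gives a product of two measures, to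
     which both [m'] and the scaled product are compared. *)
  rewrite -(@product_measure_unique _ _ _ _ _ (mscale k (mu i)) (sum_law mu s) m')//.
    rewrite (@product_measure_unique _ _ _ _ _ (mscale k (mu i)) (sum_law mu s)
      (mscale k (mu i \x sum_law mu s)%E))//= => [|C D mC mD].
      by rewrite /mscale kE.
    by rewrite /mscale -muleA; congr (_ * _)%E; exact: product_measure1E.
  move=> C D mC mD; rewrite /m' /= /pushforward/= /mrestr/=.
  (* On a rectangle, the condition [X i] in [C] becomes one of the outside events, and the induction
     hypothesis applies to [i :: r]. *)
  pose B' j := if j == i then C else B j.
  have mB' j : measurable (B' j) by rewrite /B'; case: ifP.
  have usir : uniq (s ++ i :: r).
    by rewrite -cat_rcons -cats1 -catA uniq_catCA.
  have := IHs (i :: r) D B' usir mD mB'.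
  rewrite !big_cons.
  have rE j : j \in r -> X j @^-1` B' j = X j @^-1` B j.
    move=> jr; rewrite /B'; case: eqP => // ji; rewrite -ji in ur.
    by rewrite /= jr in ur.
  have -> : \big[setI/setT]_(j <- r) (X j @^-1` B' j) = E.
    by rewrite big_seq /E [RHS]big_seq; apply: eq_bigr.
  have -> : (\prod_(j <- r) P (X j @^-1` B' j) = P E)%E.
    rewrite /E mutually_independent_seq//; last by case/andP: ur.
    by rewrite big_seq [RHS]big_seq; apply: eq_bigr => j /rE ->.
  rewrite {1 2}/B' eqxx Xmu// /mscale kE => IH.
  rewrite (_ : W @^-1` (C `*` D) `&` E = (fun x => \sum_(j <- s) X j x) @^-1` D `&`
                                         (X i @^-1` C `&` E)).
    by rewrite IH muleC [(mu i C * _)%E]muleC.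
  by rewrite setIA [X in X `&` E]setIC; apply/seteqP; split.
rewrite (_ : _ @^-1` A = W @^-1` ((fun z => z.1 + z.2) @^-1` A)); last first.
  by apply/seteqP; split => x /=; rewrite big_cons.
rewrite -mutually_independent_seq//; last by case/andP: ur.
rewrite muleC; apply: joint.
by rewrite -[X in measurable X]setTI; exact: measurable_sum2.
Qed.

Lemma independent_sum_law (R : realType) (d : measure_display)
    (T : measurableType d) (P : probability T R) (I : choiceType)
    (X : I -> {RV P >-> R}) (mu : I -> probability R R) (s : seq I) (A : set R) :
  mutually_independent X ->
  (forall i A, measurable A -> P (X i @^-1` A) = mu i A) ->
  uniq s -> measurable A ->
  P ((fun x => \sum_(i <- s) X i x) @^-1` A) = sum_law mu s A.
Proof.
move=> iX Xmu us mA.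
have := @independent_sum_joint _ _ _ _ _ X mu s [::] A (fun=> setT) iX Xmu.
by rewrite cats0 !big_nil setIT mule1; apply.
Qed.

Lemma mgf_sum_law (R : realType) (I : Type) (mu : I -> probability R R)
    (l : seq I) (s : R) :
  mgf (sum_law mu l) s = (\prod_(i <- l) mgf (mu i) s)%E.
Proof.
elim: l => [|i l IHl]; rewrite ?(big_nil, big_cons) /=.
  by rewrite mgf_dirac mul0r expR0.
by rewrite mgf_convolution IHl.
Qed.

(** * Independent variables with prescribed laws *)

(** Indices outside [J] receive the whole line, a sure event of probability 1. *)
Lemma mutually_independent_fin (R : realType) (d : measure_display)
    (T : measurableType d) (P : probability T R) (I : finType)
    (X : I -> {RV P >-> R}) :
  (forall B : I -> set R, (forall i, measurable (B i)) ->
    P (\big[setI/setT]_i (X i @^-1` B i)) = (\prod_i P (X i @^-1` B i))%E) ->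
  mutually_independent X.
Proof.
move=> H J B mB; rewrite bigcap_fset !big_uniq ?fset_uniq//=.
have := H (fun i => if i \in J then B i else setT).
rewrite [in X in _ -> X]big_mkcond [in X in _ -> _ = X]big_mkcond/= => E.
rewrite [LHS](_ : _ = P (\big[setI/[set: T]]_i (X i @^-1` (if i \in J then B i else setT)))).
  rewrite E => [|i]; last by case: ifP.
  by apply: eq_bigr => i _; case: ifP => // _; rewrite preimage_setT probability_setT.
by congr (P _); apply: eq_bigr => i _; case: ifP => // _; rewrite preimage_setT.
Qed.

(** Induction on [n]: the space is multiplied by a line with law [mu n]. The last variable reads the
    new coordinate, the others the old space. *)
Lemma exists_independent (R : realType) (mu : nat -> probability R R) (n : nat) :
  exists (d : measure_display) (T : measurableType d) (P : probability T R)
         (X : 'I_n -> {RV P >-> R}),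
    mutually_independent X /\
    forall i A, measurable A -> P (X i @^-1` A) = mu i A.
Proof.
elim: n => [|n [d [T [P [X [iX Xmu]]]]]].
  exists _, R, (dirac (0 : R)), (fun=> cst 0); split => [|[]//] J B mB.
  rewrite bigcap_fset; have -> : enum_fset J = [::].
    by case: (enum_fset J) => // -[].
  by rewrite !big_nil; exact: probability_setT.
pose Q : probability (T * R)%type R := (P \x mu n)%E.
pose Y (i : 'I_n.+1) : {RV Q >-> R} :=
  if unlift ord_max i is Some j then mfun_of (measurableT_comp (measurable_funPT (X j)) measurable_fst)
  else mfun_of measurable_snd.
have liftE (j : 'I_n) : lift ord_max j = j :> nat.
  by rewrite /= /bump leqNgt ltn_ord.
have Ymax (A : set R) : Y ord_max @^-1` A = setT `*` A.
  by rewrite /Y unlift_none; apply/seteqP; split => -[x y] //= [].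
have Ylift j (A : set R) : Y (lift ord_max j) @^-1` A = (X j @^-1` A) `*` setT.
  by rewrite /Y liftK; apply/seteqP; split => -[x y] //= [].
have YQ i A : measurable A -> Q (Y i @^-1` A) = mu i A.
  move=> mA; case: (unliftP ord_max i) => [j ->|->].
    rewrite Ylift [LHS]product_measure1E//; last exact: measurable_funPTI.
    rewrite [X in (_ * X)%E]probability_setT mule1 liftE.
    exact: Xmu.
  by rewrite Ymax [LHS]product_measure1E// [X in (X * _)%E]probability_setT mul1e.
exists _, (T * R)%type, Q, Y; split => //.
apply: mutually_independent_fin => B mB; rewrite !big_ord_recr/=.
have wE (j : 'I_n) : widen_ord (leqnSn n) j = lift ord_max j.
  exact/val_inj/esym/liftE.
rewrite (_ : \big[setI/setT]_(j < n) _ =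
    (\big[setI/setT]_(j < n) (X j @^-1` B (lift ord_max j))) `*` setT).
  rewrite [X in (_ * X)%E]YQ// Ymax -setXI setIT setTI [LHS]product_measure1E//; last first.
    exact: (@bigcap_preimage_measurable _ _ _ _ X _ (fun j => B (lift ord_max j))).
  congr (_ * _)%E.
  rewrite [LHS](mutually_independent_seq (B := fun j => B (lift ord_max j)) iX) ?index_enum_uniq//.
  by apply: eq_bigr => j _; rewrite wE YQ// liftE Xmu.
elim/big_rec2 : _ => [|j U V _ ->]; first by rewrite setXTT.
by rewrite wE Ylift -setXI setIT.
Qed.

(** * Translated uniform laws *)

Definition subtractR (R : realType) (g : R) : measurableTypeR R -> measurableTypeR R :=
  fun x => x - g.

Lemma measurable_subtractR (R : realType) (g : R) :
  measurable_fun [set: measurableTypeR R] (subtractR g).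
Proof. by apply: measurable_funB; [exact: measurable_id|exact: measurable_cst]. Qed.

(** Lebesgue measure is determined by half-open intervals, whose lengths translation preserves. *)
Lemma lebesgue_measure_shift (R : realType) (g : R) (A : set R) :
  measurable A ->
  pushforward lebesgue_measure (subtractR g) A = lebesgue_measure A.
Proof.
pose pushg : {measure set (measurableTypeR R) -> \bar R} :=
  pushforward lebesgue_measure (subtractR g).
move=> mA; apply/esym/(@lebesgue_measure_unique _ (pushg (@measurable_subtractR R g)))
  => //= _ [[a b]] _ <-.
rewrite /pushforward (_ : _ @^-1` _ = `]a + g, b + g]%classic).
  rewrite !lebesgue_measure_itv/= !lte_fin ltrD2r.
  by case: ifP => // _; rewrite -!EFinB; congr EFin; ring.
by apply/seteqP; split => x /=; rewrite /subtractR !in_itv/= ltrBrDr lerBlDr.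
Qed.

(** Change of variables: the density on the translated interval, composed with [subtractR g], is the
    original density. *)
Lemma uniform_prob_shift (R : realType) (a b g : R) (ab : a < b)
    (abg : a - g < b - g) (A : set R) : measurable A ->
  uniform_prob ab (subtractR g @^-1` A) = uniform_prob abg A.
Proof.
pose pushg : {measure set (measurableTypeR R) -> \bar R} :=
  pushforward lebesgue_measure (subtractR g).
move=> mA; transitivity
    (\int[pushg (@measurable_subtractR R g)]_(y in A) (uniform_pdf (a - g) (b - g) y)%:E)%E.
  rewrite [RHS](ge0_integral_pushforward (@measurable_subtractR R g))//.
  - apply: eq_integral => x _ /=; congr EFin.
    by rewrite /uniform_pdf /subtractR !lerD2r opprB addrA subrK.
  - by apply/measurable_EFinP/measurable_funTS; exact: measurable_uniform_pdf.
  - by move=> x _; rewrite lee_fin uniform_pdf_ge0.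
by apply: eq_measure_integral => B mB _; exact: lebesgue_measure_shift.
Qed.

Lemma uniform_or_dirac_shift (R : realType) (a b g : R) (A : set R) :
  measurable A ->
  uniform_or_dirac a b ((fun x => x - g) @^-1` A) =
  uniform_or_dirac (a - g) (b - g) A.
Proof.
move=> mA; rewrite /uniform_or_dirac.
case: pselect => [ab|nab]; case: pselect => [abg|nabg].
- exact: uniform_prob_shift.
- by exfalso; apply: nabg; rewrite ltrD2r.
- by exfalso; apply: nab; rewrite ltrD2r in abg.
- by rewrite /= !diracE.
Qed.

Lemma uniform_or_diracxx (R : realType) (a : R) (A : set R) :
  uniform_or_dirac a a A = dirac a A.
Proof. by rewrite /uniform_or_dirac; case: pselect => // aa; have := aa; rewrite ltxx. Qed.

Lemma law_eq (R : realType) (d : measure_display) (T : measurableType d)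
    (P : probability T R) (X : {RV P >-> R}) (nu : set R -> \bar R) :
  law X = to_law nu <-> forall A, measurable A -> P (X @^-1` A) = nu A.
Proof.
split => [E A mA|H]; last by apply/funext => -[A mA]; exact: H.
by have /(congr1 (fun h => h (exist _ A mA))) := E.
Qed.

Lemma law_uniform_eq (R : realType) (d : measure_display) (T : measurableType d)
    (P : probability T R) (X : {RV P >-> R}) (a b : R) :
  law X = uniform_law a b <->
  forall A, measurable A -> P (X @^-1` A) = uniform_or_dirac a b A.
Proof. by rewrite -to_law_uniform_or_dirac; exact: law_eq. Qed.

Lemma probability_preimage_cst (R : realType) (d : measure_display)
    (T : measurableType d) (P : probability T R) (X : T -> R) (c : R)
    (A : set R) :
  (forall x, X x = c) -> P (X @^-1` A) = dirac c A.
Proof.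
move=> Xc; rewrite diracE; case: (asboolP (A c)) => Ac.
  rewrite mem_set// (_ : X @^-1` A = setT) ?probability_setT//.
  by apply/seteqP; split => x //= _; rewrite Xc.
rewrite memNset// (_ : X @^-1` A = set0) ?measure0//.
by apply/seteqP; split => x //=; rewrite Xc.
Qed.

(** * The law of c + S_t *)

Lemma measurable_shift (R : realType) (c : R) :
  measurable_fun [set: R] (fun x : R => c + x).
Proof. by apply: measurable_funD; [exact: measurable_cst|exact: measurable_id]. Qed.

Definition shift_law (R : realType) (c : R) (nu : probability R R) :
  probability R R := distribution nu (mfun_of (measurable_shift c)).

Lemma mgf_shift_law (R : realType) (c s : R) (nu : probability R R) :
  mgf (shift_law c nu) s = ((expR (c * s))%:E * mgf nu s)%E.
Proof.
have e0 (x : R) : (0 <= (expR (s * x))%:E)%E by rewrite lee_fin expR_ge0.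
rewrite /mgf (ge0_integral_distribution _ (measurable_expRM s))//.
rewrite -ge0_integralZl//; last exact: measurable_expRM.
by apply: eq_integral => x _ /=; rewrite mulrDr expRD EFinM mulrC.
Qed.

Definition centered_uniform (R : realType) (t : R ^nat) (k : nat) :
  probability R R := uniform_or_dirac (- (t k / 2)) (t k / 2).

(** The value of the map at [(c, t)], built from measures alone and so independent of any space
    carrying the summands. *)
Definition shifted_S (R : realType) (c : R) (t : R ^nat) : probability R R :=
  shift_law c (sum_law (centered_uniform t) (fset_set (support_set t))).

Lemma is_law_shifted_S_unique (R : realType) (c : R) (t : R ^nat)
    (nu : borel_law R) : finite_set (support_set t) ->
  is_law_shifted_S c t nu -> nu = to_law (shifted_S c t).
Proof.
move=> ft [d [T [P [X [[iX Xu] ->]]]]]; apply/law_eq => A mA.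
rewrite fsbig_finite//=.
have mcA : measurable ((fun x : R => c + x) @^-1` A).
  by rewrite -[X in measurable X]setTI; exact: measurable_shift.
rewrite [RHS](_ : _ = sum_law (centered_uniform t) (fset_set (support_set t))
  ((fun x : R => c + x) @^-1` A))//.
rewrite -(independent_sum_law iX)//; last first.
  by move=> i B mB; move/law_uniform_eq: (Xu i); exact.
by congr (P _); apply/seteqP; split => x /=; rewrite mfun_sum.
Qed.

Lemma finite_support_bound (R : realType) (t : R ^nat) :
  finite_set (support_set t) -> exists n, forall k, (n <= k)%N -> t k = 0.
Proof.
move=> ft; exists (\max_(k <- fset_set (support_set t)) k).+1 => k nk.
apply/eqP/negPn/negP => tk; move: nk; rewrite ltnNge => /negP; apply.
by apply: (leq_bigmax_seq (F := id)) => //; rewrite in_fset_set// inE.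
Qed.

(** By uniqueness, realizing c + S_t on some space is enough. *)
Lemma is_law_shifted_S_exists (R : realType) (c : R) (t : R ^nat) :
  finite_set (support_set t) -> is_law_shifted_S c t (to_law (shifted_S c t)).
Proof.
move=> ft; suff [nu nut] : exists nu, is_law_shifted_S c t nu.
  by rewrite -(is_law_shifted_S_unique ft nut).
have [n tn] := finite_support_bound ft.
have [d [T [P [X [iX Xt]]]]] := exists_independent (centered_uniform t) n.
(* From [n] on, [t k = 0], and the constant 0 has law U[0, 0]. *)
pose Y k : {RV P >-> R} := if insub k is Some i then X i else cst 0.
eexists; exists d, T, P, Y; split; last by [].
split.
  apply: (mutually_independent_reindex (X := X) (f := insub) (g := fun=> id)
      (c := fun=> 0)) => //.
  - move=> k k' i; case: insubP => // j _ jk [<-]; case: insubP => // j' _ j'k' [jj'].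
    by rewrite -jk -j'k' jj'.
  - by move=> k i ki x; rewrite /Y ki.
  - by move=> k kN x; rewrite /Y kN.
move=> k; apply/law_uniform_eq => A mA; rewrite /Y.
case: insubP => [i _ <-|]; first exact: Xt.
rewrite -leqNgt => /tn ->; rewrite mul0r oppr0 uniform_or_diracxx.
exact: probability_preimage_cst.
Qed.

(** The shift [c] becomes one further summand U[c, c], placed at the last index; the other indices
    enumerate the support. *)
Lemma shifted_S_finite_gen (R : realType) (c : R) (t : R ^nat) :
  l2_decr_fin R t -> finite_gen_unif_sum_law R (to_law (shifted_S c t)).
Proof.
move=> [[_ t0 _] ft].
have [d [T [P [X [[iX Xu] ->]]]]] := is_law_shifted_S_exists c ft.
set s : seq nat := fset_set (support_set t).
pose n := size s.
pose f (i : 'I_n.+1) := omap (fun j : 'I_n => nth 0%N s j) (unlift ord_max i).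
pose Y (i : 'I_n.+1) : {RV P >-> R} := if f i is Some k then X k else cst c.
pose a i := if f i is Some k then - (t k / 2) else c.
pose b i := if f i is Some k then t k / 2 else c.
exists n.+1, a, b; split.
  move=> i; rewrite /a /b; case: (f i) => // k.
  by rewrite ge0_cp// divr_ge0.
exists d, T, P, Y; split; last first.
  have sumY x : (\sum_(i < n.+1) Y i) x = c + \sum_(k <- s) X k x.
    rewrite mfun_sum big_ord_recr/= addrC (big_nth 0%N) big_mkord; congr (_ + _).
      by rewrite /Y /f unlift_none.
    apply: eq_bigr => i _.
    have -> : widen_ord (leqnSn n) i = lift ord_max i.
      by apply: val_inj; rewrite /= /bump leqNgt ltn_ord.
    by rewrite /Y /f liftK.
  apply/funext => -[A mA]; congr (P _).
  by apply/seteqP; split => x /=; rewrite fsbig_finite//= sumY mfun_sum.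
split.
  apply: (mutually_independent_reindex (X := X) (f := f) (g := fun=> id)
      (c := fun=> c)) => //.
  - move=> i i' k; rewrite /f.
    case: unliftP => //= j -> [jk]; case: unliftP => //= j' -> [j'k].
    congr lift; apply/val_inj.
    have us : uniq s by exact: fset_uniq.
    by apply/eqP; rewrite -(nth_uniq 0%N (ltn_ord j) (ltn_ord j') us) jk j'k.
  - by move=> i k ik x; rewrite /Y ik.
  - by move=> i iN x; rewrite /Y iN.
move=> i; apply/law_uniform_eq => A mA; rewrite /Y /a /b; case: (f i) => [k|].
  by move/law_uniform_eq: (Xu k); exact.
by rewrite uniform_or_diracxx; exact: probability_preimage_cst.
Qed.

(** * Injectivity *)

(** The common factor e^(c s) p makes the quotient M(2 s) / M(s) visible. Any bound [n] on the
    support is allowed, so two sequences can share the same number of factors. *)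
Lemma mgf_shifted_S (R : realType) (c : R) (t : R ^nat) (n : nat) (s : R) :
  (forall k, 0 <= t k) -> (forall k, (n <= k)%N -> t k = 0) -> 0 < s ->
  exists2 p : R, 0 < p &
    mgf (shifted_S c t) s = (expR (c * s) * p)%:E /\
    mgf (shifted_S c t) (2 * s) =
      (expR (c * s) * p * (expR (c * s) *
         \prod_(x <- mkseq t n) (expR (s * (x / 2)) + expR (- (s * (x / 2))))) /
       2 ^+ n)%:E.
Proof.
move=> t0 tn s0.
(* Indices below [n] outside the support carry point masses at 0, whose transform is 1. *)
have prodE r : (\prod_(k <- fset_set (support_set t)) mgf (centered_uniform t k) r =
    \prod_(k <- iota 0 n) mgf (centered_uniform t k) r)%E.
  have ft : finite_set (support_set t).
    apply: (@sub_finite_set _ _ `I_n); last exact: finite_II.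
    by move=> k /= tk; rewrite ltnNge; apply: contra_neqN tk => /tn.
  rewrite -fsbig_finite//= (fsbig_widen _ `I_n).
  - by rewrite -fsbig_ord -val_enum_ord big_map big_enum.
  - by move=> k /= tk; rewrite ltnNge; apply: contra_neqN tk => /tn.
  - move=> k /= [_ /negP]; rewrite negbK => /eqP tk.
    rewrite /centered_uniform tk mul0r oppr0 /uniform_or_dirac.
    case: pselect => [lt00|_]; first by have := lt00; rewrite ltxx.
    by rewrite mgf_dirac mul0r expR0.
have [m [m0 m1 m2]] : exists m : nat -> R, [/\ forall k, 0 < m k,
    forall k, mgf (centered_uniform t k) s = (m k)%:E &
    forall k, mgf (centered_uniform t k) (2 * s) =
      (m k * ((expR (s * (t k / 2)) + expR (- (s * (t k / 2)))) / 2))%:E].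
  have /choice[m Hm] k : exists m : R, 0 < m /\
      mgf (centered_uniform t k) s = m%:E /\
      mgf (centered_uniform t k) (2 * s) =
      (m * ((expR (s * (t k / 2)) + expR (- (s * (t k / 2)))) / 2))%:E.
    by have [m m0 mE] := mgf_centered_uniform (t0 k) s0; exists m.
  by exists m; split => k; have [? []] := Hm k.
exists (\prod_(k <- iota 0 n) m k); first by elim/big_ind : _ => // *; exact: mulr_gt0.
rewrite !mgf_shift_law !mgf_sum_law !prodE; split.
  by rewrite (eq_bigr (fun k => (m k)%:E))// prodEFin.
rewrite (eq_bigr _ (fun k _ => m2 k)).
rewrite prodEFin -EFinM; congr EFin.
rewrite big_map !big_split/= big_const_seq count_predT size_iota iter_mulr_1.
rewrite (_ : c * (2 * s) = c * s + c * s) ?expRD; last by ring.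
by rewrite exprVn; ring.
Qed.

Lemma shifted_S_inj (R : realType) (c d : R) (t u : R ^nat) :
  l2_decr_fin R t -> l2_decr_fin R u ->
  to_law (shifted_S c t) = to_law (shifted_S d u) -> c = d /\ t = u.
Proof.
move=> [[td t0 _] ft] [[ud u0 _] fu] E.
have mgfE s : mgf (shifted_S c t) s = mgf (shifted_S d u) s.
  apply: eq_measure_integral => A mA _.
  by have /(congr1 (fun h => h (exist _ A mA))) := E.
have [n1 tn1] := finite_support_bound ft.
have [n2 un2] := finite_support_bound fu.
pose n := maxn n1 n2.
have tn k : (n <= k)%N -> t k = 0 by rewrite geq_max => /andP[/tn1].
have un k : (n <= k)%N -> u k = 0 by rewrite geq_max => /andP[_ /un2].
(* Reversal turns decreasing sequences into the ascending lists of [prod_expR_cosh_inj]. *)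
have sorted_rev (v : R ^nat) : (forall k, v k.+1 <= v k) ->
    sorted <=%R (rev (mkseq v n)).
  move=> vd; rewrite rev_sorted; apply/(sortedP 0) => i.
  rewrite size_mkseq => i1n; rewrite !nth_mkseq//; last exact: ltnW.
have ge0_rev (v : R ^nat) : (forall k, 0 <= v k) -> all (>= 0) (rev (mkseq v n)).
  by move=> v0; rewrite all_rev; apply/allP => x /mapP[k _ ->].
have [||||||-> /(can_inj revK) tu] :=
    @prod_expR_cosh_inj R (rev (mkseq t n)) (rev (mkseq u n)) c d; rewrite ?size_rev ?size_mkseq//.
- exact: ge0_rev.
- exact: ge0_rev.
- exact: sorted_rev.
- exact: sorted_rev.
- move=> s s0; rewrite !big_rev.
  have [p p0 [p1 p2]] := mgf_shifted_S c t0 tn s0.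
  have [q q0 [q1 q2]] := mgf_shifted_S d u0 un s0.
  (* The transforms agree at [s]; cancelling this common factor from their equality at [2 * s]
     leaves the products of cosines. *)
  have pq : expR (c * s) * p = expR (d * s) * q.
    by apply: EFin_inj; rewrite -p1 -q1.
  have : (mgf (shifted_S c t) (2 * s) = mgf (shifted_S d u) (2 * s))%E by [].
  rewrite p2 q2 => -[]; rewrite pq => /mulIf; rewrite invr_eq0 => /(_ (lt0r_neq0 (exprn_gt0 _ _))).
  move=> /(_ (ltr0n _ _)) /mulfI; apply.
  by rewrite mulf_neq0// gt_eqF// expR_gt0.
split => //; apply/funext => k; have [nk|kn] := leqP n k; first by rewrite tn// un.
by have /(congr1 (fun l => nth 0 l k)) := tu; rewrite !nth_mkseq.
Qed.

(** * Surjectivity *)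

Lemma cvg_series_eventually0 (R : realType) (u : R ^nat) (m : nat) :
  (forall k, (m <= k)%N -> u k = 0) -> cvgn (series u).
Proof.
move=> um; apply/cvg_ex; exists (series u m); apply: cvg_near_cst.
exists m => // n /= mn; rewrite /series/= (big_cat_nat (leq0n m) mn)//=.
rewrite [X in _ + X](_ : _ = 0) ?addr0// big_nat_cond.
by apply: big1 => k /andP[/andP[/um]].
Qed.

Lemma l2_decr_fin_nth (R : realType) (v : seq R) :
  sorted >=%R v -> all (>= 0) v -> l2_decr_fin R (nth 0 v).
Proof.
move=> sv /allP v0.
have vge0 k : 0 <= nth 0 v k.
  have [kv|vk] := ltnP k (size v); first by apply: v0; exact: mem_nth.
  by rewrite nth_default.
split; first split => // [k|].
- have [kv|vk] := ltnP k.+1 (size v); first exact: (sortedP 0 sv).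
  by rewrite nth_default.
- apply: (@cvg_series_eventually0 _ _ (size v)) => k vk.
  by rewrite nth_default// expr0n.
apply: (@sub_finite_set _ _ `I_(size v)); last exact: finite_II.
move=> k /= vk; rewrite ltnNge; apply: contra_neqN vk => vk.
by rewrite nth_default.
Qed.

(** Each U[a, b] is its midpoint [g] plus a centred uniform of width [w]. The midpoints add up to
    [c], and the widths in decreasing order form [t]. *)
Lemma finite_gen_shifted_S (R : realType) (nu : borel_law R) :
  finite_gen_unif_sum_law R nu ->
  exists c t, l2_decr_fin R t /\ nu = to_law (shifted_S c t).
Proof.
move=> [m [a [b [ab [d [T [P [X [[iX Xu] ->]]]]]]]]].
pose w i := b i - a i.
pose g i := (a i + b i) / 2.
(* [X i] is only almost surely constant when [w i = 0]; replacing it by a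
   constant does not change the law of the sum. *)
pose X' i : {RV P >-> R} := if w i == 0 then (cst (a i) : {mfun T >-> R}) else X i.
have iX' : mutually_independent X'.
  apply: (mutually_independent_reindex (X := X)
    (f := fun i => if w i == 0 then None else Some i) (g := fun=> id) (c := a)) => //.
  - by move=> i i' j; case: ifP => // _ [->]; case: ifP => // _ [->].
  - by move=> i j; rewrite /X'; case: ifP => // _ [->].
  - by move=> i; rewrite /X'; case: ifP.
have Xu_ i A : measurable A -> P (X i @^-1` A) = uniform_or_dirac (a i) (b i) A.
  by move/law_uniform_eq : (Xu i); exact.
have X'u i A : measurable A -> P (X' i @^-1` A) = uniform_or_dirac (a i) (b i) A.
  move=> mA; rewrite /X'; case: ifP => [/eqP wi|_]; last exact: Xu_.
  have -> : b i = a i by apply/eqP; rewrite -subr_eq0; apply/eqP.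
  by rewrite uniform_or_diracxx; exact: probability_preimage_cst.
have -> : law (\sum_(i < m) X i : {RV P >-> R}) = law (\sum_(i < m) X' i : {RV P >-> R}).
  apply/funext => -[A mA].
  transitivity (sum_law (fun i => uniform_or_dirac (a i) (b i)) (index_enum 'I_m) A).
    rewrite -(independent_sum_law iX Xu_ (index_enum_uniq _) mA); congr (P _).
    by apply/seteqP; split => x /=; rewrite mfun_sum.
  rewrite -(independent_sum_law iX' X'u (index_enum_uniq _) mA); congr (P _).
  by apply/seteqP; split => x /=; rewrite mfun_sum.
pose s := sort (fun i j => w j <= w i) (enum 'I_m).
have ps : perm_eq s (enum 'I_m) by rewrite perm_sort.
have us : uniq s by rewrite sort_uniq enum_uniq.
have sm : size s = m by rewrite (perm_size ps) size_enum_ord.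
(* The original index of the [k]-th largest width, or [None] from [m] on. *)
pose f k := nth None (map Some s) k.
pose t := nth 0 (map w s).
have fS k i : f k = Some i -> k = index i s.
  have [km|mk] := ltnP k (size s); last by rewrite /f nth_default ?size_map.
  by rewrite /f (nth_map i)// => -[ki]; rewrite -[in RHS]ki index_uniq.
have tS k i : f k = Some i -> t k = w i.
  have [km|mk] := ltnP k (size s); last by rewrite /f nth_default ?size_map.
  by rewrite /f /t !(nth_map i)// => -[->].
have fN k : f k = None -> t k = 0.
  have [km|mk] := ltnP k (size s); last by rewrite /t nth_default ?size_map.
  have i0 : 'I_m by rewrite -sm; exact: (Ordinal km).
  by rewrite /f (nth_map i0).
pose Y k : {RV P >-> R} :=
  if f k is Some i then X' i \- cst (g i) : {mfun T >-> R} else cst 0.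
have lt : l2_decr_fin R t.
  apply: l2_decr_fin_nth.
    by rewrite sorted_map; apply: sort_sorted => i j; exact: le_total.
  by apply/allP => x /mapP[i _ ->]; rewrite subr_ge0.
exists (\sum_i g i), t; split => //.
apply: is_law_shifted_S_unique; first by case: lt.
exists d, T, P, Y; split; first split.
- apply: (mutually_independent_reindex (X := X') (f := f)
    (g := fun k x => x - (if f k is Some i then g i else 0)) (c := fun=> 0)) => //.
  + by move=> k k' i /fS -> /fS ->.
  + by move=> k; apply: measurable_funB; [exact: measurable_id|exact: measurable_cst].
  + by move=> k i fk x; rewrite /Y fk.
  + by move=> k fk x; rewrite /Y fk.
- move=> k; apply/law_uniform_eq => A mA; rewrite /Y.
  case fk : (f k) => [i|]; last first.
    by rewrite fN// mul0r oppr0 uniform_or_diracxx; exact: probability_preimage_cst.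
  rewrite (tS _ _ fk).
  have -> : - (w i / 2) = a i - g i by rewrite /w /g; field.
  have -> : w i / 2 = b i - g i by rewrite /w /g; field.
  rewrite -uniform_or_dirac_shift// -X'u//.
  have mg : measurable_fun [set: R] (fun x : R => x - g i).
    by apply: measurable_funB; [exact: measurable_id|exact: measurable_cst].
  by rewrite -[X in measurable X]setTI; exact: mg.
(* This holds at every point: a zero width falls outside the support, but there [X' i] equals its
   midpoint exactly, so the omitted term is 0. *)
have sumE x : \sum_(i < m) X' i x =
    \sum_i g i + (\sum_(k \in support_set t) Y k) x.
  rewrite fsbig_finite; last by case: lt.
  rewrite /= mfun_sum -fsbig_finite; last by case: lt.
  rewrite (fsbig_widen _ `I_m).
  - rewrite -fsbig_ord.
    rewrite (_ : \sum_(k < m) Y k x = \sum_(i <- s) (X' i x - g i)).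
      by rewrite (perm_big _ ps)/= big_enum -big_split/=; apply: eq_bigr => i _; rewrite addrC subrK.
    rewrite -(big_map Some xpredT (fun o => if o is Some i then X' i x - g i else 0)).
    rewrite (big_nth None) size_map sm big_mkord; apply: eq_bigr => k _.
    by rewrite /Y /f; case: nth.
  - move=> k /= tk; rewrite ltnNge; apply: contra_neqN tk => mk.
    by rewrite /t nth_default// size_map sm.
  - move=> k /= [_ /negP]; rewrite negbK => /eqP tk; rewrite /Y.
    case fk : (f k) => [i|]//=; rewrite (tS _ _ fk) in tk.
    have ba : b i = a i by apply/eqP; rewrite -subr_eq0; apply/eqP.
    by rewrite /X' tk eqxx /= /g ba; field.
apply/funext => -[A mA]; congr (P _).
by apply/seteqP; split => x /=; rewrite -sumE mfun_sum.
Qed.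

(* The first conjunct says that F is the map sending (c, t) to the distribution
   of c + S_t, and in particular that this map is well defined. *)
Theorem theorem3p5 (R : realType) :
  exists F : R * R ^nat -> borel_law R,
    (forall (c : R) (t : R ^nat), l2_decr_fin R t ->
       forall nu : borel_law R, is_law_shifted_S c t nu <-> nu = F (c, t)) /\
    set_bij ([set: R] `*` l2_decr_fin R) (finite_gen_unif_sum_law R) F.
Proof.
exists (fun ct => to_law (shifted_S ct.1 ct.2)); split => [c t [_ ft] nu|].
  split => [|->]; first exact: is_law_shifted_S_unique.
  exact: is_law_shifted_S_exists.
split.
- by move=> [c t] [_ lt]; exact: shifted_S_finite_gen.
- move=> [c t] [d u] /set_mem[_ lt] /set_mem[_ lu] /= E.
  by have /= [-> ->] := shifted_S_inj lt lu E.
- move=> nu /finite_gen_shifted_S[c [t [lt ->]]].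
  by exists (c, t).
Qed.
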